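(* Let $\mathbf{u}$ and $\mathbf{x}$ be finite nonempty sets, let $\varepsilon: F(\mathbf{u}) \to F(\mathbf{x})$ be a homomorphism, let $\mathbf{v} \subseteq F(\mathbf{u})$ and let $G$ be the group presented by $\langle \mathbf{u} : \mathbf{v} \rangle$. Let $\hat{G}$ be the group presented by $\langle \mathbf{x} : \varepsilon(\mathbf{v}) \rangle$. Then $\varepsilon$ induces a homomorphism $\varepsilon: G \to \hat{G}$, and there is an exact sequence of homomorphisms $$1 \to \langle\langle \varepsilon(G) \rangle\rangle \xrightarrow{\ i\ } \hat{G} \xrightarrow{\ \pi\ } H \to 1,$$ where $H$ is the group presented by $\langle \mathbf{x} : \varepsilon(\mathbf{u}) \rangle$ and $\langle\langle \varepsilon(G) \rangle\rangle$ is the normal closure of $\varepsilon(G)$ in $\hat{G}$.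
   Context: $F(S)$ denotes the free group on a set $S$. The induced map $\varepsilon: G\to\hat G$ sends the class of $w \in F(\mathbf{u})$ to the class of $\varepsilon(w)$; $i$ is the inclusion, and $\pi$ is the map induced by the identity on the generators $\mathbf{x}$. *)

(* Defs.v *)
From HB Require Import structures.
From mathcomp Require Import all_boot monoid.
From mathcomp Require Import boolp classical_sets.

Set Implicit Arguments.
Unset Strict Implicit.
Unset Printing Implicit Defensive.

Local Open Scope quotient_scope.
Local Open Scope group_scope.
Local Open Scope classical_set_scope.

Notation group_hom := UMagmaMorphism.type.

Section NormalClosure.
Variable G : groupType.
Implicit Types (A N : set G) (x y : G).

Definition normal_subgroup N : Prop :=
  [/\ N 1, forall x y, N x -> N y -> N (x * y), forall x, N x -> N x^-1
    & forall x y, N x -> N (x ^ y)].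

Definition normal_closure A : set G :=
  \bigcap_(N in [set N | normal_subgroup N /\ A `<=` N]) N.

Lemma sub_normal_closure A : A `<=` normal_closure A.
Proof. by move=> x Ax N [_ sAN]; apply: sAN. Qed.

Lemma normal_closure_normal A : normal_subgroup (normal_closure A).
Proof.
split=> [|x y clx cly|x clx|x y clx] N /= [nN sAN]; have [N1 NM NV NJ] := nN.
- exact: N1.
- by apply: NM; [apply: clx | apply: cly].
- by apply: NV; apply: clx.
- by apply: NJ; apply: clx.
Qed.

Lemma normal_closure_sub A N :
  normal_subgroup N -> A `<=` N -> normal_closure A `<=` N.
Proof. by move=> nN sAN x; apply. Qed.

Record normal_closure_group A := NormalClosureGroup {
  normal_closure_val : G;
  _ : normal_closure_val \in normal_closure A
}.

End NormalClosure.

Section NormalClosureGroup.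
Variables (G : groupType) (A : set G).

HB.instance Definition _ := [isSub for @normal_closure_val G A].
HB.instance Definition _ := [Choice of normal_closure_group A by <:].

Fact normal_closure_closed :
  group_closed (fun x : G => x \in normal_closure A).
Proof.
have [N1 NM NV _] := normal_closure_normal A.
split=> [|x y]; first by rewrite unfold_in in_setE.
by rewrite !unfold_in !in_setE => ? ?; apply: NM => //; apply: NV.
Qed.

HB.instance Definition _ := SubChoice_isSubGroup.Build G
  (fun x : G => x \in normal_closure A) (normal_closure_group A)
  normal_closure_closed.

Definition normal_closure_incl : group_hom (normal_closure_group A) G :=
  UMagmaMorphism.clone (normal_closure_group A) G \val _.

End NormalClosureGroup.

(* The free group on [S] is the group of reduced words; the letter [(s, b)]
   stands for [s] if [b = false] and for [s^-1] if [b = true]. *)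
Section FreeGroup.
Variable S : choiceType.
Implicit Types (a b : S * bool) (w : seq (S * bool)).

Definition letter_inv a : S * bool := (a.1, ~~ a.2).

Definition reduced w : bool := sorted [rel a b | b != letter_inv a] w.

Record free_group := FreeGroup {
  free_word : seq (S * bool);
  _ : reduced free_word
}.

HB.instance Definition _ := [isSub for free_word].
HB.instance Definition _ := [Choice of free_group by <:].

Definition red_cons a w : seq (S * bool) :=
  if w is b :: w' then if b == letter_inv a then w' else a :: w else [:: a].

Definition red_cat w1 w2 : seq (S * bool) := foldr red_cons w2 w1.

Definition word_inv w : seq (S * bool) := rev (map letter_inv w).

Lemma letter_invK : involutive letter_inv.
Proof. by case=> s b; rewrite /letter_inv /= negbK. Qed.

Lemma reduced_behead a w : reduced (a :: w) -> reduced w.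
Proof. exact: path_sorted. Qed.

Lemma reduced_cons a w : reduced w -> reduced (red_cons a w).
Proof.
case: w => [|b w] //= rw; case: ifP => [_|/negbT ne].
  exact: reduced_behead rw.
by rewrite /reduced /= ne.
Qed.

Lemma reduced_cat w1 w2 : reduced w2 -> reduced (red_cat w1 w2).
Proof. by move=> r2; elim: w1 => //= a w1; apply: reduced_cons. Qed.

Lemma red_consK a w : reduced w -> red_cons (letter_inv a) (red_cons a w) = w.
Proof.
case: w => [|b w] /=; first by rewrite letter_invK eqxx.
case: ifP => [/eqP-> | _] rw /=; last by rewrite letter_invK eqxx.
case: w rw => [|c w] //=; rewrite /reduced /= => /andP[ne _].
by rewrite (negbTE ne).
Qed.

Lemma red_consVK a w : reduced w -> red_cons a (red_cons (letter_inv a) w) = w.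
Proof. by rewrite -{1}(letter_invK a); apply: red_consK. Qed.

Lemma red_cat_cons a w1 w2 : reduced w2 ->
  red_cat (red_cons a w1) w2 = red_cons a (red_cat w1 w2).
Proof.
case: w1 => [|b w1] //= r2; case: ifP => [/eqP->|_] //=.
by rewrite red_consVK //; apply: reduced_cat.
Qed.

Lemma red_catA w1 w2 w3 : reduced w3 ->
  red_cat w1 (red_cat w2 w3) = red_cat (red_cat w1 w2) w3.
Proof. by move=> r3; elim: w1 => //= a w1 ->; rewrite red_cat_cons. Qed.

Lemma red_cat0 w : reduced w -> red_cat w [::] = w.
Proof.
elim: w => //= a w IHw rw; rewrite IHw ?(reduced_behead rw) //.
by case: w rw {IHw} => //= b w; rewrite /reduced /= => /andP[/negbTE->].
Qed.

Lemma red_catV w : reduced w -> red_cat (word_inv w) w = [::].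
Proof.
elim: w => //= a w IHw rw; rewrite /word_inv /= rev_cons -cats1 /red_cat.
by rewrite foldr_cat /= letter_invK eqxx; apply: IHw (reduced_behead rw).
Qed.

Lemma reduced_inv w : reduced w -> reduced (word_inv w).
Proof.
rewrite /reduced /word_inv rev_sorted sorted_map; apply: sub_sorted.
by move=> a b; apply: contra => /eqP /= ab; rewrite -(letter_invK b) -ab.
Qed.

Lemma word_invK : involutive word_inv.
Proof. by move=> w; rewrite /word_inv map_rev revK mapK //; apply: letter_invK. Qed.

Definition free_one : free_group := @FreeGroup [::] isT.
Definition free_mul (f g : free_group) : free_group :=
  FreeGroup (reduced_cat (val f) (valP g)).
Definition free_inv (f : free_group) : free_group :=
  FreeGroup (reduced_inv (valP f)).

Fact free_mulA : associative free_mul.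
Proof. by move=> f g h; apply: val_inj => /=; apply: red_catA (valP h). Qed.
Fact free_mul1 : left_id free_one free_mul.
Proof. by move=> f; apply: val_inj. Qed.
Fact free_mulr1 : right_id free_one free_mul.
Proof. by move=> f; apply: val_inj; apply: red_cat0 (valP f). Qed.
Fact free_mulV : left_inverse free_one free_inv free_mul.
Proof. by move=> f; apply: val_inj; apply: red_catV (valP f). Qed.
Fact free_mulrV : right_inverse free_one free_inv free_mul.
Proof.
move=> f; apply: val_inj => /=; rewrite -{1}[free_word f]word_invK.
exact: red_catV (reduced_inv (valP f)).
Qed.

HB.instance Definition _ := isGroup.Build free_group
  free_mulA free_mul1 free_mulr1 free_mulV free_mulrV.

Definition free_gen (s : S) : free_group := @FreeGroup [:: (s, false)] isT.

End FreeGroup.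

(* The group presented by <S : R>, i.e. the quotient of [free_group S] by the
   normal closure of [R]. *)
Section Presentation.
Variables (S : choiceType) (R : set (free_group S)).
Local Notation F := (free_group S).
Local Notation N := (normal_closure R).

Definition pres_rel (f g : F) : bool := f^-1 * g \in N.

Fact pres_rel_equiv : equiv_class_of pres_rel.
Proof.
have [N1 NM NV _] := normal_closure_normal R.
split=> [f|f g|g f h]; rewrite /pres_rel.
- by rewrite mulVg in_setE.
- by apply/idP/idP; rewrite !in_setE => /NV; rewrite invgM invgK.
- rewrite !in_setE => fg gh.
  by have := NM _ _ fg gh; rewrite mulgA mulgK.
Qed.

Canonical pres_equiv_rel := EquivRelPack pres_rel_equiv.

Definition presented_group := {eq_quot pres_rel}.

HB.instance Definition _ := Choice.on presented_group.
HB.instance Definition _ := EqQuotient.on presented_group.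

Definition pres_class (f : F) : presented_group := \pi f.

Lemma pres_classP f g : pres_class f = pres_class g <-> N (f^-1 * g).
Proof.
split=> [/eqmodP|Nfg]; first by rewrite /= /pres_rel in_setE.
by apply/eqmodP; rewrite /= /pres_rel in_setE.
Qed.

Definition pres_one : presented_group := pres_class 1.
Definition pres_mul (p q : presented_group) : presented_group :=
  pres_class (repr p * repr q).
Definition pres_inv (p : presented_group) : presented_group :=
  pres_class (repr p)^-1.

Lemma pres_class_repr p : pres_class (repr p) = p.
Proof. exact: reprK. Qed.

Lemma pres_mulE f g : pres_mul (pres_class f) (pres_class g) = pres_class (f * g).
Proof.
have [_ NM _ NJ] := normal_closure_normal R.
have /pres_classP Nf := pres_class_repr (pres_class f).
have /pres_classP Ng := pres_class_repr (pres_class g).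
apply/pres_classP; set f' := repr _ in Nf *; set g' := repr _ in Ng *.
have := NM _ _ (NJ _ g' Nf) Ng.
by rewrite conjgE invgM !mulgA mulgK.
Qed.

Lemma pres_invE f : pres_inv (pres_class f) = pres_class f^-1.
Proof.
have [_ _ NV NJ] := normal_closure_normal R.
have /pres_classP Nf := pres_class_repr (pres_class f).
apply/pres_classP; set f' := repr _ in Nf *; rewrite invgK.
have := NJ _ f^-1 (NV _ Nf).
by rewrite conjgE invgM !invgK !mulgA mulgV mul1g.
Qed.

Lemma pres_class_ind (P : presented_group -> Prop) :
  (forall f, P (pres_class f)) -> forall p, P p.
Proof. by move=> Pcl p; rewrite -(pres_class_repr p). Qed.

Fact pres_mulA : associative pres_mul.
Proof.
elim/pres_class_ind=> f; elim/pres_class_ind=> g; elim/pres_class_ind=> h.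
by rewrite !pres_mulE mulgA.
Qed.
Fact pres_mul1 : left_id pres_one pres_mul.
Proof. by elim/pres_class_ind=> f; rewrite pres_mulE mul1g. Qed.
Fact pres_mulr1 : right_id pres_one pres_mul.
Proof. by elim/pres_class_ind=> f; rewrite pres_mulE mulg1. Qed.
Fact pres_mulV : left_inverse pres_one pres_inv pres_mul.
Proof. by elim/pres_class_ind=> f; rewrite pres_invE pres_mulE mulVg. Qed.
Fact pres_mulrV : right_inverse pres_one pres_inv pres_mul.
Proof. by elim/pres_class_ind=> f; rewrite pres_invE pres_mulE mulgV. Qed.

HB.instance Definition _ := isGroup.Build presented_group
  pres_mulA pres_mul1 pres_mulr1 pres_mulV pres_mulrV.

Fact pres_class_morphism : monoid_morphism pres_class.
Proof. by split=> // f g; rewrite -pres_mulE. Qed.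

HB.instance Definition _ := isUMagmaMorphism.Build _ _ pres_class
  pres_class_morphism.

End Presentation.

Fact unit_mulA : associative (fun _ _ : unit => tt). Proof. by []. Qed.
Fact unit_mul1 : left_id tt (fun _ _ : unit => tt). Proof. by case. Qed.
Fact unit_mulr1 : right_id tt (fun _ _ : unit => tt). Proof. by case. Qed.
Fact unit_mulV : left_inverse tt id (fun _ _ : unit => tt). Proof. by []. Qed.
Fact unit_mulrV : right_inverse tt id (fun _ _ : unit => tt). Proof. by []. Qed.
HB.instance Definition _ := isGroup.Build unit
  unit_mulA unit_mul1 unit_mulr1 unit_mulV unit_mulrV.

Definition exact_at (A B C : groupType) (f : A -> B) (g : B -> C) : Prop :=
  range f = [set y | g y = 1].

(* Exactness of 1 -> A -> B -> C -> 1 at A, B and C; [unit] is the trivial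
   group. *)
Definition short_exact (A B C : groupType)
    (i : group_hom A B) (p : group_hom B C) : Prop :=
  [/\ exact_at (fun _ : unit => 1 : A) i,
      exact_at i p
    & exact_at p (fun _ : C => 1 : unit)].

(* Main.v *)
(** A homomorphism out of [F(S)] killing [R] factors through [<S : R>], because
    its kernel is normal; this gives both induced maps.  The element [eps w]
    lies in the normal closure of [eps(u)] for every [w], since the preimage of
    that closure under [eps] is a subgroup containing the generators.  Both
    inclusions of exactness at the middle term then come from pulling back
    normal subgroups along a homomorphism. *)
From HB Require Import structures.
Require Import Defs.
From mathcomp Require Import all_boot monoid boolp classical_sets.

Local Open Scope classical_set_scope.

Lemma normal_subgroup_preimage (A B : groupType) (f : group_hom A B) (N : set B) :
  normal_subgroup N -> normal_subgroup (f @^-1` N).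
Proof.
move=> [N1 NM NV NJ]; split=> /= [|y z|y|y z]; rewrite /preimage /=.
- by rewrite gmulf1.
- by rewrite gmulfM; apply: NM.
- by rewrite gmulfV; apply: NV.
- by rewrite gmulfJ; apply: NJ.
Qed.

Lemma normal_subgroup1 (A : groupType) : normal_subgroup [set 1%g : A].
Proof.
split=> [//|y z /= -> ->|y /= ->|y z /= ->].
- by rewrite mulg1.
- by rewrite invg1.
- by rewrite conj1g.
Qed.

Lemma normal_subgroup_ker (A B : groupType) (f : group_hom A B) :
  normal_subgroup [set y | f y = 1%g].
Proof. exact: normal_subgroup_preimage (normal_subgroup1 B). Qed.

(** Induction on the reduced word, peeling off its first letter, which is a generator or the inverse
    of one. *)
Lemma free_group_ind (S : choiceType) (P : set (free_group S)) :
  P 1%g -> (forall y z, P y -> P z -> P (y * z)%g) ->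
  (forall y, P y -> P (y^-1)%g) -> (forall s, P (free_gen s)) -> forall w, P w.
Proof.
move=> P1 PM PV Pgen [w]; elim: w => [|[s b] w IHw] rw.
  by rewrite (_ : FreeGroup rw = 1%g) //; apply: val_inj.
have rw' := reduced_behead rw.
pose l : free_group S := @FreeGroup S [:: (s, b)] isT.
have -> : FreeGroup rw = (l * FreeGroup rw')%g.
  (* Reducedness of the whole word says that the first letter does not cancel against the next one,
     so [red_cons] just prepends it. *)
  apply: val_inj => /=; case: w rw {IHw rw'} => //= c w.
  by rewrite /reduced /= => /andP[/negbTE->].
apply: PM (IHw rw'); rewrite /l; case: b {rw l}; last first.
  by rewrite (_ : FreeGroup _ = free_gen s) //; apply: val_inj.
rewrite (_ : FreeGroup _ = (free_gen s)^-1%g); first exact/PV/Pgen.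
exact: val_inj.
Qed.

Lemma free_hom_normal_closure (S : choiceType) (A : groupType)
    (f : group_hom (free_group S) A) w :
  normal_closure (f @` range (@free_gen S)) (f w).
Proof.
have [P1 PM PV _] :=
  normal_subgroup_preimage _ _ f _ (normal_closure_normal (f @` range (@free_gen S))).
apply: (free_group_ind S (f @^-1` _) P1 PM PV) => s.
by apply: sub_normal_closure; exists (free_gen s) => //; exists s.
Qed.

Lemma pres_class_eq1 (S : choiceType) (R : set (free_group S)) w :
  pres_class R w = 1%g <-> normal_closure R w.
Proof.
have [_ _ NV _] := normal_closure_normal R.
rewrite (_ : 1%g = pres_class R 1%g) //.
split=> [/pres_classP/NV|Nw]; first by rewrite invgM invgK invg1 mul1g.
by apply/pres_classP; rewrite mulg1; apply: NV.
Qed.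

Lemma pres_lift (S : choiceType) (R : set (free_group S)) (A : groupType)
    (f : group_hom (free_group S) A) :
  (forall r, R r -> f r = 1%g) ->
  exists phi : group_hom (presented_group R) A,
    forall w, phi (pres_class R w) = f w.
Proof.
(* The map is defined through the chosen representative; [phiE] shows that the choice is immaterial,
   since two representatives differ by an element of the normal closure of [R], on which [f] is
   trivial. *)
move=> fR; pose phi (p : presented_group R) := f (repr p).
have phiE w : phi (pres_class R w) = f w.
  have /pres_classP Nw := pres_class_repr (pres_class R w).
  have /= := normal_closure_sub (normal_subgroup_ker _ _ f) fR Nw.
  by rewrite gmulfM gmulfV => /mulg1_eq; rewrite invgK.
have phiM : monoid_morphism phi.
  split; first exact: etrans (phiE 1%g) gmulf1.
  elim/pres_class_ind=> y; elim/pres_class_ind=> z.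
  by rewrite -gmulfM !phiE gmulfM.
pose phi_hom := isUMagmaMorphism.Build _ _ phi phiM.
by exists (HB.pack_for (group_hom (presented_group R) A) phi phi_hom).
Qed.

Lemma range_normal_closure_incl (G : groupType) (A : set G) :
  range (normal_closure_incl A) = normal_closure A.
Proof.
apply/seteqP; split=> [_ [y _ <-]|y Ny] /=; first by rewrite -in_setE; apply: valP.
by rewrite -in_setE in Ny; exists (NormalClosureGroup Ny).
Qed.

(** Exactness at the left end is injectivity of the inclusion and at the right end surjectivity of
    [p], so the theorem reduces to computing a kernel. *)
Lemma short_exact_normal_closure (G H : groupType) (A : set G) (p : group_hom G H) :
  (forall h, exists g, p g = h) -> normal_closure A = [set g | p g = 1%g] ->
  short_exact (normal_closure_incl A) p.
Proof.
move=> p_surj kerp; split; rewrite /exact_at.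
- apply/seteqP; split=> [_ [_ _ <-]|y /= y1]; first exact: gmulf1.
  by exists tt => //; apply: val_inj; rewrite /= y1.
- by rewrite range_normal_closure_incl.
- by apply/seteqP; split=> // h _; have [g <-] := p_surj h; exists g.
Qed.

Theorem theorem1p1 (u x : finType) (u_gt0 : 0 < #|u|) (x_gt0 : 0 < #|x|)
    (eps : group_hom (free_group u) (free_group x)) (v : set (free_group u)) :
  let G := presented_group v in
  let Ghat := presented_group (eps @` v) in
  let H := presented_group (eps @` range (@free_gen u)) in
  exists2 epsG : group_hom G Ghat,
    forall w : free_group u, epsG (pres_class v w) = pres_class (eps @` v) (eps w) &
    exists2 pi : group_hom Ghat H,
      forall s : x, pi (pres_class (eps @` v) (free_gen s))
                    = pres_class (eps @` range (@free_gen u)) (free_gen s) &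
      short_exact (normal_closure_incl (range epsG)) pi.
Proof.
move=> G Ghat H.
have [|epsG epsGE] := pres_lift _ v Ghat (pres_class (eps @` v) \o eps).
  by move=> r vr; apply/pres_class_eq1; apply: sub_normal_closure; exists r.
have [|pi piE] := pres_lift _ (eps @` v) H (pres_class _).
  (* Membership of [r] in [v] is dropped: [eps] of any word in [u] dies in [H]. *)
  by move=> _ [r _ <-]; apply/pres_class_eq1; apply: free_hom_normal_closure.
exists epsG => //; exists pi => [s|]; first exact: piE.
apply: short_exact_normal_closure.
  by elim/pres_class_ind=> w; exists (pres_class _ w).
apply/seteqP; split.
  apply: normal_closure_sub (normal_subgroup_ker _ _ pi) _ => _ [y _ <-] /=.
  elim/pres_class_ind: y => w; rewrite epsGE /= piE.
  by apply/pres_class_eq1; apply: free_hom_normal_closure.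
(* For the reverse inclusion, pull the closure of [range epsG] back to the free group on [x]. This
   normal subgroup contains [eps] of each generator, hence every word that is trivial in [H]. *)
have nM := normal_subgroup_preimage _ _ (pres_class (eps @` v)) _
  (normal_closure_normal (range epsG)).
elim/pres_class_ind=> w /=; rewrite piE => /pres_class_eq1 Nw.
apply: (normal_closure_sub nM _ Nw) => _ [_ [s _ <-] <-].
by apply: sub_normal_closure; exists (pres_class v (free_gen s)).
Qed.
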